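(* In the ambient intuitionistic metatheory, the index-period classification of congruences $c$ on the additive monoid $(\mathbb{N}_\delta,+,0)$ has the following three forms. (a) If $c$ is decidable and an explicit pair $a\neq b$ with $c(a,b)$ is given, then $c=\equiv_{i,p}$ for a unique pair $i\ge0$, $p\ge1$. This is proved without using $\mathrm{EM}$, $\mathrm{LPO}$ or $\mathrm{MP}$. (b) Assuming $\mathrm{MP}$: if $c$ is decidable and is not equality, then $c=\equiv_{i,p}$ for a unique pair $i\ge0$, $p\ge1$. (c) Assuming $\mathrm{EM}$: an arbitrary congruence $c$ is either equality or $c=\equiv_{i,p}$ for a unique pair $i\ge0$, $p\ge1$. Conversely, the general statements in (b) and (c) (that is, the conclusion of (b) for all decidable congruences that are not equality, and the dichotomy in (c) for all congruences) imply $\mathrm{MP}$ and $\mathrm{EM}$, respectively.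
   Context: The ambient metatheory is intuitionistic type theory without excluded middle or choice. $\mathbb{N}_\delta$ is the inductive type with constructors $0$ and $r\mapsto Sr$, with addition $x+0=x$, $x+Sy=S(x+y)$. The map $D\colon\mathbb{N}_\delta\to\mathbb{N}$ is given by $D(0)=0$, $D(St)=D(t)+1$. A congruence on $(\mathbb{N}_\delta,+,0)$ is an equivalence relation compatible with $+$. It is decidable if $c(x,y)\vee\neg c(x,y)$ holds for all $x,y$. It ''is equality'' if $c(x,y)\to x=y$ for all $x,y$; ''is not equality'' is the negation of this statement, $\neg\forall x,y\,(c(x,y)\to x=y)$. Equality of relations means having the same related pairs. For $i\ge0$, $p\ge1$ in $\mathbb{N}$, the relation $\equiv_{i,p}$ is: $x\equiv_{i,p}y$ iff $x=y$, or ($D(x)\ge i$, $D(y)\ge i$ and $D(x)\equiv D(y)\pmod p$). $\mathrm{EM}$ is $P\vee\neg P$ for every ambient proposition $P$. $\mathrm{MP}$ (Markov's principle) is: for every decidable predicate $\theta$ on $\mathbb{N}$, $\neg\neg\exists n\,\theta(n)\to\exists n\,\theta(n)$. $\mathrm{LPO}$ is: for every decidable predicate $\theta$ on $\mathbb{N}$, $\exists n\,\theta(n)\vee\forall n\,\neg\theta(n)$. *)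

(* Defs.v *)
From Stdlib Require Import Arith RelationClasses.

(* The ambient intuitionistic logic is Rocq's own, with [Prop] as the
   propositions.  That the classification with a given related pair needs no
   EM, LPO or MP, and that the converses hold constructively, is visible only
   in a proof that uses no axioms. *)

Inductive Ndelta : Type :=
| dzero : Ndelta
| dsucc : Ndelta -> Ndelta.

Fixpoint dadd (x y : Ndelta) : Ndelta :=
  match y with
  | dzero => x
  | dsucc y' => dsucc (dadd x y')
  end.

Fixpoint D (t : Ndelta) : nat :=
  match t with
  | dzero => 0
  | dsucc t' => D t' + 1
  end.

Record congruence (c : Ndelta -> Ndelta -> Prop) : Prop := {
  congruence_equiv : Equivalence c;
  congruence_dadd : forall x x' y y' : Ndelta,
    c x x' -> c y y' -> c (dadd x y) (dadd x' y')
}.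

(* Decidability is a [Prop]-valued disjunction, not [sumbool]. *)
Definition decidable_rel (c : Ndelta -> Ndelta -> Prop) : Prop :=
  forall x y : Ndelta, c x y \/ ~ c x y.

Definition is_equality (c : Ndelta -> Ndelta -> Prop) : Prop :=
  forall x y : Ndelta, c x y -> x = y.

Definition index_period (i p : nat) (x y : Ndelta) : Prop :=
  x = y \/ (i <= D x /\ i <= D y /\ D x mod p = D y mod p).

(* Uniqueness is that of the pair, whence [exists!] over [nat * nat]: the
   nested [exists! i, exists! p] would be a different statement. *)
Definition has_unique_index_period (c : Ndelta -> Ndelta -> Prop) : Prop :=
  exists! ip : nat * nat,
    1 <= snd ip /\
    forall x y : Ndelta, c x y <-> index_period (fst ip) (snd ip) x y.

Definition EM : Prop := forall P : Prop, P \/ ~ P.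

Definition MP : Prop :=
  forall theta : nat -> Prop,
    (forall n : nat, theta n \/ ~ theta n) ->
    ~ ~ (exists n : nat, theta n) -> exists n : nat, theta n.

(* Main.v *)
From Stdlib Require Import Arith RelationClasses Wf_nat Lia.
Require Import Defs.

(** The additive monoid is generated by 1, so a congruence on it amounts to an
    equivalence relation [r] on [nat] that is invariant under translation.
    Everything about such an [r] follows from one remark ([step_transfer]): call
    [q] a step at [m] when [r m (m + q)]; as soon as [m] has a positive step, it
    has every step that occurs anywhere, because the positive step carries [m]
    arbitrarily far up, past the place where the other step is available.
    Hence, given a related pair [a < b], the least positive step [p] at [a]
    divides all the steps that occur, and the elements having a positive step are
    exactly those having step [p], so they are the numbers from the least one
    [i] on: [r] is the congruence of index [i] and period [p].  With [r]
    decidable, both minima are searches for the least element of a decidable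
    predicate known to be inhabited, hence constructive.

    For (b), what is missing is a related pair of distinct elements, and Markov's
    principle supplies it once its existence is expressed by a decidable predicate
    of a single number.  The classical fact that a finite monogenic semigroup has
    an idempotent does this: a related pair of distinct elements exists if and
    only if [r n (n + n)] for some positive [n] ([idempotent_of_step]).
    Excluded middle makes every relation decidable and implies Markov's
    principle, so (c) follows from (b).

    For the converses, an ideal [I] of the monoid yields the Rees congruence, which
    identifies all the elements of [I].  It is equality only if [I] is empty, and
    if it has an index and a period then [I] is inhabited.  The
    ideal of numbers at or above a witness of [theta] gives Markov's principle, and the
    ideal [fun _ => P] gives excluded middle for [P]. *)

(** * Natural numbers and their unary copy *)

Fixpoint of_nat (n : nat) : Ndelta :=
  match n with
  | 0 => dzero
  | S n' => dsucc (of_nat n')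
  end.

Lemma D_of_nat n : D (of_nat n) = n.
Proof. induction n as [|n IH]; simpl; lia. Qed.

Lemma of_nat_D x : of_nat (D x) = x.
Proof.
  induction x as [|x IH]; simpl; [reflexivity|].
  rewrite Nat.add_1_r; simpl; congruence.
Qed.

Lemma of_nat_add m n : of_nat (m + n) = dadd (of_nat m) (of_nat n).
Proof.
  induction n as [|n IH]; simpl.
  - now rewrite Nat.add_0_r.
  - now rewrite Nat.add_succ_r; simpl; rewrite IH.
Qed.

Lemma D_dadd x y : D (dadd x y) = D x + D y.
Proof. induction y as [|y IH]; simpl; lia. Qed.

Lemma D_inj x y : D x = D y -> x = y.
Proof. intros E; rewrite <- (of_nat_D x), <- (of_nat_D y); now f_equal. Qed.

Lemma Ndelta_eq_dec (x y : Ndelta) : x = y \/ x <> y.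
Proof.
  destruct (Nat.eq_dec (D x) (D y)) as [E|E].
  - left; now apply D_inj.
  - right; congruence.
Qed.

(** * Translation-invariant equivalences on the natural numbers *)

Record translation_equivalence (r : nat -> nat -> Prop) : Prop := {
  te_equiv : Equivalence r;
  te_shift : forall k m n, r m n -> r (k + m) (k + n)
}.

Definition on_nat (c : Ndelta -> Ndelta -> Prop) (m n : nat) : Prop :=
  c (of_nat m) (of_nat n).

Lemma on_nat_D c x y : on_nat c (D x) (D y) <-> c x y.
Proof. unfold on_nat; now rewrite !of_nat_D. Qed.

Lemma on_nat_translation c : congruence c -> translation_equivalence (on_nat c).
Proof.
  intros [Hequiv Hadd]; split.
  - split; intro m; unfold on_nat; [|intro n|intros n k]; intros;
      [reflexivity | now symmetry | now transitivity (of_nat n)].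
  - intros k m n H; unfold on_nat; rewrite !of_nat_add.
    apply Hadd; [reflexivity | exact H].
Qed.

Lemma step_multiple r m q k :
  translation_equivalence r -> r m (m + q) -> r m (m + k * q).
Proof.
  intros [Hequiv Hshift] H; induction k as [|k IH]; simpl.
  - rewrite Nat.add_0_r; reflexivity.
  - transitivity (m + q); [exact H|].
    replace (m + (q + k * q)) with (q + (m + k * q)) by lia.
    rewrite (Nat.add_comm m q); now apply Hshift.
Qed.

Lemma step_up r m n q :
  translation_equivalence r -> m <= n -> r m (m + q) -> r n (n + q).
Proof.
  intros [_ Hshift] Hle H.
  replace (n + q) with ((n - m) + (m + q)) by lia.
  replace n with ((n - m) + m) at 1 by lia.
  now apply Hshift.
Qed.

(** With [k] large enough, [m] is related to [m + k * q >= n], where the step [p]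
    is available, and [m + p] is related to [m + k * q + p] by translation. *)
Lemma step_transfer r m n q p :
  translation_equivalence r ->
  1 <= q -> r m (m + q) -> r n (n + p) -> r m (m + p).
Proof.
  intros Hr Hq Hm Hn.
  pose proof (te_equiv r Hr) as Hequiv.
  pose proof (step_multiple r m q n Hr Hm) as Hup.
  transitivity (m + n * q); [exact Hup|].
  transitivity (m + n * q + p).
  - apply (step_up r n); [exact Hr | nia | exact Hn].
  - symmetry; rewrite !(Nat.add_comm _ p).
    now apply te_shift.
Qed.

(** The Euclidean remainder of a step by another is again a step, so a least
    positive step divides all the others. *)
Lemma least_step_divides r a p q :
  translation_equivalence r -> 1 <= p -> r a (a + p) ->
  (forall p', 1 <= p' -> r a (a + p') -> p <= p') ->
  r a (a + q) -> Nat.divide p q.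
Proof.
  intros Hr Hp Hap Hmin Haq.
  pose proof (te_equiv r Hr) as Hequiv.
  pose proof (Nat.div_mod_eq q p) as Eq.
  pose proof (Nat.mod_upper_bound q p ltac:(lia)) as Hlt.
  assert (Hrem : r a (a + q mod p)).
  { transitivity (a + q); [exact Haq|].
    replace (a + q) with (q mod p + (a + q / p * p)) by lia.
    rewrite (Nat.add_comm a (q mod p)).
    symmetry; apply te_shift, step_multiple; assumption. }
  apply Nat.Lcm0.mod_divide.
  destruct (q mod p) as [|s] eqn:Es; [reflexivity|].
  pose proof (Hmin (S s) ltac:(lia) Hrem); lia.
Qed.

Lemma least_of_decidable (P : nat -> Prop) :
  (forall n, P n \/ ~ P n) -> (exists n, P n) ->
  exists n, P n /\ forall n', P n' -> n <= n'.
Proof.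
  intros Hdec Hex.
  destruct (dec_inh_nat_subset_has_unique_least_element P Hdec Hex)
    as [n [Hn _]].
  now exists n.
Qed.

Lemma le_mod_eq_multiple p m n :
  1 <= p -> m <= n -> (m mod p = n mod p <-> Nat.divide p (n - m)).
Proof.
  intros Hp Hle; split.
  - intros E; exists (n / p - m / p).
    rewrite (Nat.div_mod_eq m p) at 1.
    rewrite (Nat.div_mod_eq n p) at 1.
    rewrite E, Nat.mul_sub_distr_r; nia.
  - intros [k Ek].
    replace n with (m + k * p) by lia.
    now rewrite Nat.Div0.mod_add.
Qed.

(** It is enough to describe the steps: a related pair [m <= n] is the step
    [n - m] at [m]. *)
Lemma index_period_of_steps r i p :
  translation_equivalence r -> 1 <= p -> r i (i + p) ->
  (forall m q, 1 <= q -> r m (m + q) -> i <= m /\ Nat.divide p q) ->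
  forall m n, r m n <-> m = n \/ (i <= m /\ i <= n /\ m mod p = n mod p).
Proof.
  intros Hr Hp Hi Hsteps.
  pose proof (te_equiv r Hr) as Hequiv.
  assert (Hle : forall m n, m < n ->
    r m n <-> i <= m /\ i <= n /\ m mod p = n mod p).
  { intros m n Hlt; split.
    - intros H.
      destruct (Hsteps m (n - m)) as [Him Hdiv]; [lia | |].
      + now replace (m + (n - m)) with n by lia.
      + apply le_mod_eq_multiple in Hdiv; [lia | lia | lia].
    - intros (Him & _ & E).
      apply le_mod_eq_multiple in E as [k Ek]; [|lia|lia].
      replace n with (m + k * p) by lia.
      apply step_multiple, (step_up r i); assumption. }
  intros m n; destruct (Nat.lt_trichotomy m n) as [Hlt | [<- | Hlt]].
  - rewrite (Hle m n Hlt); lia.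
  - split; [now left | reflexivity].
  - split.
    + intros H; symmetry in H; apply (Hle n m Hlt) in H; lia.
    + intros H; symmetry; apply (Hle n m Hlt); lia.
Qed.

(** [p] is the least positive step at [a] and [i] is the least number having step
    [p]. *)
Lemma index_period_exists r a q :
  translation_equivalence r -> (forall m n, r m n \/ ~ r m n) ->
  1 <= q -> r a (a + q) ->
  exists i p, 1 <= p /\
    forall m n, r m n <-> m = n \/ (i <= m /\ i <= n /\ m mod p = n mod p).
Proof.
  intros Hr Hdec Hq Haq.
  destruct (least_of_decidable (fun p => 1 <= p /\ r a (a + p)))
    as (p & [Hp Hap] & Hpmin).
  { intros p; destruct (le_dec 1 p), (Hdec a (a + p)); tauto. }
  { now exists q. }
  destruct (least_of_decidable (fun i => r i (i + p))) as (i & Hi & Himin).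
  { intros i; apply Hdec. }
  { now exists a. }
  exists i, p; split; [exact Hp|].
  apply index_period_of_steps; try assumption.
  intros m s Hs Hm; split.
  - apply Himin, (step_transfer r m a s); assumption.
  - apply (least_step_divides r a); try assumption.
    + intros p' Hp' Hap'; now apply Hpmin.
    + apply (step_transfer r a m p); assumption.
Qed.

(** [(a + 1) * q] is a multiple of the step [q], and lies above [a]. *)
Lemma idempotent_of_step r a q :
  translation_equivalence r -> 1 <= q -> r a (a + q) ->
  exists n, r (S n) (S n + S n).
Proof.
  intros Hr Hq Haq.
  exists (pred (S a * q)).
  rewrite Nat.succ_pred by nia.
  apply step_multiple, (step_up r a); [exact Hr | exact Hr | nia | exact Haq].
Qed.

(** * The classification *)

Lemma on_nat_positive_step c a b :
  congruence c -> a <> b -> c a b ->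
  exists m q, 1 <= q /\ on_nat c m (m + q).
Proof.
  intros Hc Hab H.
  pose proof (congruence_equiv c Hc) as Hequiv.
  assert (HD : D a <> D b) by (intros E; now apply Hab, D_inj).
  destruct (proj1 (Nat.lt_gt_cases _ _) HD) as [Hlt | Hlt].
  - exists (D a), (D b - D a); split; [lia|].
    replace (D a + (D b - D a)) with (D b) by lia.
    now apply on_nat_D.
  - exists (D b), (D a - D b); split; [lia|].
    replace (D b + (D a - D b)) with (D a) by lia.
    apply on_nat_D; now symmetry.
Qed.

Lemma index_period_of_nat i p m n :
  index_period i p (of_nat m) (of_nat n) <->
  m = n \/ (i <= m /\ i <= n /\ m mod p = n mod p).
Proof.
  unfold index_period; rewrite !D_of_nat.
  split; (intros [E|H]; [left | now right]).
  - apply (f_equal D) in E; now rewrite !D_of_nat in E.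
  - now f_equal.
Qed.

(** The pair [i], [i + p] is related; relating it by the other congruence bounds
    the other index by [i] and makes the other period divide [p]. *)
Lemma index_period_incl i p i' p' :
  1 <= p -> 1 <= p' ->
  (forall x y, index_period i p x y -> index_period i' p' x y) ->
  i' <= i /\ Nat.divide p' p.
Proof.
  intros Hp Hp' Hincl.
  assert (H : index_period i p (of_nat i) (of_nat (i + p))).
  { apply index_period_of_nat; right; repeat split; [lia | lia |].
    apply le_mod_eq_multiple; [lia | lia | exists 1; lia]. }
  apply Hincl, index_period_of_nat in H as [H | (Hi & _ & H)]; [lia|].
  apply le_mod_eq_multiple in H; [|lia|lia].
  now replace (i + p - i) with p in H by lia.
Qed.

Lemma index_period_unique i p i' p' :
  1 <= p -> 1 <= p' ->
  (forall x y, index_period i p x y <-> index_period i' p' x y) ->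
  (i, p) = (i', p').
Proof.
  intros Hp Hp' H.
  destruct (index_period_incl i p i' p') as [Hi Hd]; try assumption.
  { intros x y; apply H. }
  destruct (index_period_incl i' p' i p) as [Hi' Hd']; try assumption.
  { intros x y; apply H. }
  f_equal; [lia | now apply Nat.divide_antisym].
Qed.

Lemma classification_of_pair c a b :
  congruence c -> decidable_rel c -> a <> b -> c a b ->
  has_unique_index_period c.
Proof.
  intros Hc Hdec Hab H.
  destruct (on_nat_positive_step c a b) as (m & q & Hq & Hm); try assumption.
  destruct (index_period_exists (on_nat c) m q) as (i & p & Hp & Hip);
    try assumption.
  { now apply on_nat_translation. }
  { intros k l; apply Hdec. }
  assert (Hchar : forall x y, c x y <-> index_period i p x y).
  { intros x y; rewrite <- on_nat_D, Hip, <- index_period_of_nat, !of_nat_D.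
    reflexivity. }
  exists (i, p); split; [now split|].
  intros [i' p'] [Hp' Hchar']; simpl in *.
  apply index_period_unique; try assumption.
  intros x y; now rewrite <- Hchar, <- Hchar'.
Qed.

(** A pair of distinct related elements cannot fail to exist, and Markov's
    principle finds one of the form [n], [n + n] with [n] positive. *)
Lemma classification_of_MP :
  MP -> forall c, congruence c -> decidable_rel c -> ~ is_equality c ->
  has_unique_index_period c.
Proof.
  intros Hmp c Hc Hdec Hneq.
  destruct (Hmp (fun n => on_nat c (S n) (S n + S n))) as [n Hn].
  { intros n; apply Hdec. }
  { intros Hnone; apply Hneq; intros x y Hxy.
    destruct (Ndelta_eq_dec x y) as [E|E]; [exact E | exfalso].
    destruct (on_nat_positive_step c x y) as (m & q & Hq & Hm); try assumption.
    apply Hnone, (idempotent_of_step _ m q); try assumption.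
    now apply on_nat_translation. }
  apply (classification_of_pair c (of_nat (S n)) (of_nat (S n + S n)));
    try assumption.
  intros E; apply (f_equal D) in E; rewrite !D_of_nat in E; lia.
Qed.

Lemma EM_MP : EM -> MP.
Proof.
  intros Hem theta _ Hnn.
  destruct (Hem (exists n, theta n)); tauto.
Qed.

(** * Rees congruences and the converses *)

Definition rees (I : nat -> Prop) (x y : Ndelta) : Prop :=
  x = y \/ (I (D x) /\ I (D y)).

Lemma rees_congruence (I : nat -> Prop) :
  (forall m n, m <= n -> I m -> I n) -> congruence (rees I).
Proof.
  intros Hup; split.
  - split.
    + intros x; now left.
    + intros x y [E|H]; [now left | right; tauto].
    + intros x y z [E|H] [E'|H']; subst; unfold rees; tauto.
  - intros x x' y y' [<-|[Hx Hx']] [<-|[Hy Hy']]; [now left | right ..];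
      rewrite !D_dadd; split.
    + apply (Hup (D y)); [lia | exact Hy].
    + apply (Hup (D y')); [lia | exact Hy'].
    + apply (Hup (D x)); [lia | exact Hx].
    + apply (Hup (D x')); [lia | exact Hx'].
    + apply (Hup (D x)); [lia | exact Hx].
    + apply (Hup (D x')); [lia | exact Hx'].
Qed.

Lemma rees_decidable (I : nat -> Prop) :
  (forall n, I n \/ ~ I n) -> decidable_rel (rees I).
Proof.
  intros Hdec x y; unfold rees.
  destruct (Ndelta_eq_dec x y), (Hdec (D x)), (Hdec (D y)); tauto.
Qed.

(** An element of the ideal would be identified with its successor. *)
Lemma rees_equality_empty (I : nat -> Prop) :
  (forall m n, m <= n -> I m -> I n) ->
  is_equality (rees I) -> forall n, ~ I n.
Proof.
  intros Hup Heq n Hn.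
  assert (E : of_nat n = of_nat (S n)).
  { apply Heq; right; rewrite !D_of_nat; split; [exact Hn|].
    apply (Hup n); [lia | exact Hn]. }
  apply (f_equal D) in E; rewrite !D_of_nat in E; lia.
Qed.

(** The distinct elements [i] and [i + p] are identified, so [i] is in the
    ideal. *)
Lemma rees_index_period_inhabited (I : nat -> Prop) :
  has_unique_index_period (rees I) -> exists n, I n.
Proof.
  intros [[i p] [[Hp Hchar] _]]; simpl in *.
  assert (H : rees I (of_nat i) (of_nat (i + p))).
  { apply Hchar, index_period_of_nat; right; repeat split; [lia | lia |].
    apply le_mod_eq_multiple; [lia | lia | exists 1; lia]. }
  exists i; destruct H as [E | [H _]]; rewrite ?D_of_nat in *; [|exact H].
  apply (f_equal D) in E; rewrite !D_of_nat in E; lia.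
Qed.

Lemma bounded_exists_decidable (theta : nat -> Prop) :
  (forall n, theta n \/ ~ theta n) ->
  forall n, (exists k, k <= n /\ theta k) \/ ~ (exists k, k <= n /\ theta k).
Proof.
  intros Hdec n; induction n as [|n [(k & Hk & Ht) | Hnone]].
  - destruct (Hdec 0) as [H|H]; [left; exists 0; auto | right].
    intros (k & Hk & Ht); now replace k with 0 in Ht by lia.
  - left; exists k; split; [lia | exact Ht].
  - destruct (Hdec (S n)) as [H|H]; [left; exists (S n); auto | right].
    intros (k & Hk & Ht).
    destruct (Nat.eq_dec k (S n)) as [->|Hne]; [now apply H|].
    apply Hnone; exists k; split; [lia | exact Ht].
Qed.

Lemma MP_of_classification :
  (forall c, congruence c -> decidable_rel c -> ~ is_equality c ->
     has_unique_index_period c) -> MP.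
Proof.
  intros Hclass theta Hdec Hnn.
  set (I := fun n => exists k, k <= n /\ theta k).
  assert (Hup : forall m n, m <= n -> I m -> I n).
  { intros m n Hle (k & Hk & Ht); exists k; split; [lia | exact Ht]. }
  destruct (rees_index_period_inhabited I) as (n & k & _ & Hk).
  - apply Hclass.
    + now apply rees_congruence.
    + now apply rees_decidable, bounded_exists_decidable.
    + intros Heq; apply Hnn; intros [k Hk].
      apply (rees_equality_empty I Hup Heq k); now exists k.
  - now exists k.
Qed.

Lemma EM_of_classification :
  (forall c, congruence c -> is_equality c \/ has_unique_index_period c) -> EM.
Proof.
  intros Hclass P.
  assert (Hup : forall m n : nat, m <= n -> P -> P) by auto.
  destruct (Hclass _ (rees_congruence (fun _ => P) Hup)) as [Heq|Hper].
  - right; exact (rees_equality_empty _ Hup Heq 0).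
  - left; now destruct (rees_index_period_inhabited _ Hper).
Qed.

Theorem theorem1p8 :
  (* (a) *)
  (forall c : Ndelta -> Ndelta -> Prop,
     congruence c -> decidable_rel c ->
     forall a b : Ndelta, a <> b -> c a b ->
     has_unique_index_period c)
  /\
  (* (b) *)
  (MP ->
   forall c : Ndelta -> Ndelta -> Prop,
     congruence c -> decidable_rel c -> ~ is_equality c ->
     has_unique_index_period c)
  /\
  (* (c) *)
  (EM ->
   forall c : Ndelta -> Ndelta -> Prop,
     congruence c -> is_equality c \/ has_unique_index_period c)
  /\
  (* converse of (b) *)
  ((forall c : Ndelta -> Ndelta -> Prop,
      congruence c -> decidable_rel c -> ~ is_equality c ->
      has_unique_index_period c) ->
   MP)
  /\
  (* converse of (c) *)
  ((forall c : Ndelta -> Ndelta -> Prop,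
      congruence c -> is_equality c \/ has_unique_index_period c) ->
   EM).
Proof.
  split; [|split; [|split; [|split]]].
  - intros c Hc Hdec a b Hab H; exact (classification_of_pair c a b Hc Hdec Hab H).
  - exact classification_of_MP.
  - intros Hem c Hc.
    destruct (Hem (is_equality c)) as [Heq|Hneq]; [now left | right].
    apply classification_of_MP; try assumption.
    + exact (EM_MP Hem).
    + intros x y; apply Hem.
  - exact MP_of_classification.
  - exact EM_of_classification.
Qed.
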